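(* Let $d \in \mathbb{N}$ and let $g(x,y) \in \mathbb{R}[x,y]$ be a polynomial of degree $d$ such that, in the polynomial ring $\mathbb{R}[x_1,x_2,y_1,y_2]$, the polynomial $y_2-y_1$ does not divide $g(x_1,y_1)-g(x_2,y_2)$. Then there is a constant $c_d>0$ depending only on $d$ such that for every finite set $A \subset \mathbb{R}$ with $|A|\ge 2$, \[ |X| \ge c_d |A|^2, \quad \text{where} \quad X:=\left\{\frac{g(a_1,b_1)-g(a_2,b_2)}{b_2-b_1} :\, a_1,a_2,b_1,b_2 \in A,\ b_1\neq b_2 \right\}. \] *)

(* Defs.v *)
From HB Require Import structures.
From mathcomp Require Import all_boot all_order all_algebra.
From mathcomp Require Import finmap reals.
From mathcomp.multinomials Require Import mpoly.

Set Implicit Arguments.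
Unset Strict Implicit.
Unset Printing Implicit Defensive.

Import GRing.Theory.
Local Open Scope ring_scope.
Local Open Scope fset_scope.

Definition mpoly_dvd (R : realType) (n : nat) (p q : {mpoly R[n]}) : Prop :=
  exists r : {mpoly R[n]}, q = r * p.

(* The variables x1, x2, y1, y2 of R[x1, x2, y1, y2] are X_0, X_1, X_2, X_3. *)
Definition x1 {R : realType} : {mpoly R[4]} := 'X_(@Ordinal 4 0 isT).
Definition x2 {R : realType} : {mpoly R[4]} := 'X_(@Ordinal 4 1 isT).
Definition y1 {R : realType} : {mpoly R[4]} := 'X_(@Ordinal 4 2 isT).
Definition y2 {R : realType} : {mpoly R[4]} := 'X_(@Ordinal 4 3 isT).

Definition subst2 (R : realType) (g : {mpoly R[2]}) (u v : {mpoly R[4]}) :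
    {mpoly R[4]} :=
  g \mPo [tuple u; v].

Definition eval2 (R : realType) (g : {mpoly R[2]}) (a b : R) : R :=
  g.@[tnth [tuple a; b]].

(* msize is one more than the total degree, and is 0 for the zero polynomial,
   which therefore has no degree d : nat. *)
Definition has_degree (R : realType) (n : nat) (p : {mpoly R[n]}) (d : nat) :
    Prop :=
  msize p = d.+1.

(* p = (a1, b1) and q = (a2, b2). *)
Definition quotient_set (R : realType) (g : {mpoly R[2]}) (A : {fset R}) :
    {fset R} :=
  [fset (eval2 g p.1 p.2 - eval2 g q.1 q.2) / (q.2 - p.2)
     | p in A `*` A, q in A `*` A & p.2 != q.2].

Lemma quotient_setP (R : realType) (g : {mpoly R[2]}) (A : {fset R}) (t : R) :
  reflect
    (exists a1 a2 b1 b2 : R,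
      [/\ [/\ a1 \in A, a2 \in A, b1 \in A & b2 \in A],
          b1 <> b2
        & t = (eval2 g a1 b1 - eval2 g a2 b2) / (b2 - b1)])
    (t \in quotient_set g A).
Proof.
apply: (iffP idP).
  case/imfset2P => -[a1 b1]; rewrite /= inE => /andP[/= a1A b1A].
  case=> -[a2 b2]; rewrite inE /= inE /= => /andP[/andP[a2A b2A] /eqP neq] ->.
  by exists a1, a2, b1, b2.
case=> a1 [a2 [b1 [b2 [[a1A a2A b1A b2A] /eqP neq ->]]]].
apply/imfset2P; exists (a1, b1); first by rewrite /= inE /= a1A b1A.
by exists (a2, b2); rewrite // !inE /= a2A b2A.
Qed.

(* Main.v *)
Require Import Defs.
From mathcomp Require Import all_boot all_order all_algebra.
From mathcomp Require Import finmap reals.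
From mathcomp.multinomials Require Import mpoly.
From mathcomp Require Import zify ring lra.

(** The elements of X are the slopes of the lines joining points of
    P = {(-b, g(a, b))}. Since g involves x, some coefficient c_j(y), j > 0, of
    g as a polynomial in x is nonzero; discarding the at most d roots b of c_j,
    each value of g(., b) is taken at most d times, so |P| >= |A|(|A| - d)/d.
    It remains to see that N points, no line containing more than v of them,
    determine at least about N/2 - 2v slopes, a weak form of Ungar's theorem.
    Order P by height y - t x and let t run over the reals: the set of the
    B = N/2 lowest points starts with the leftmost and ends with the rightmost
    ones, and changes only when t is a slope. If k points leave it at the slope
    s, then k points on a common line of slope s are exchanged for k others on
    that line. Before another exchange can happen, at a slope s', one more point
    has to pass at least k collinear points, and it does so at k distinct slopes
    in (s, s']. Hence the total number of exits, which is at least B - v, is at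
    most the number of slopes plus the size of the last exchange. *)

Set Implicit Arguments.
Unset Strict Implicit.
Unset Printing Implicit Defensive.
Import Order.TTheory GRing.Theory Num.Theory.
Local Open Scope ring_scope.

(** * Differences and fibres of finite sequences, and sparse sums *)

Section UniqSequences.
Variable T : eqType.
Implicit Types A B C s : seq T.

Definition seq_diff A B := [seq x <- A | x \notin B].

Lemma seq_diff_uniq A B : uniq A -> uniq (seq_diff A B).
Proof. exact: filter_uniq. Qed.

Lemma mem_seq_diff A B x : (x \in seq_diff A B) = (x \notin B) && (x \in A).
Proof. by rewrite mem_filter. Qed.

Lemma size_seq_diffC A B : uniq A -> uniq B -> size A = size B ->
  size (seq_diff A B) = size (seq_diff B A).
Proof.
move=> uA uB sAB; rewrite !size_filter.
have eqI : count (mem B) A = count (mem A) B.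
  rewrite -!size_filter; apply/perm_size/uniq_perm; rewrite ?filter_uniq //.
  by move=> x; rewrite !mem_filter andbC.
have := count_predC (mem B) A; have := count_predC (mem A) B.
rewrite -sAB -eqI => <- /addnI.
by rewrite /predC /=.
Qed.

Lemma size_seq_diff_triangle A B C : uniq A ->
  (size (seq_diff A C) <= size (seq_diff A B) + size (seq_diff B C))%N.
Proof.
move=> uA; rewrite -size_cat uniq_leq_size ?seq_diff_uniq // => x.
by rewrite mem_cat !mem_seq_diff => /andP[-> ->]; case: (x \in B).
Qed.

Lemma seq_diff_eq0 A B : uniq A -> size A = size B ->
  size (seq_diff A B) = 0%N -> A =i B.
Proof.
move=> uA sAB /size0nil d0.
have sub : {subset A <= B}.
  move=> x xA; apply: contraT => xB.
  by have := mem_seq_diff A B x; rewrite d0 xB xA.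
by have [] := uniq_min_size uA sub; rewrite ?sAB.
Qed.

(** Double counting: the fibre sizes over the distinct values add up to [size s]. *)
Lemma size_fibers (U : eqType) (f : T -> U) (s : seq T) (k : nat) :
    (forall y, (count (fun x => f x == y) s <= k)%N) ->
  (size s <= k * size (undup (map f s)))%N.
Proof.
move=> fib.
have -> : size s = (\sum_(y <- undup (map f s)) count (fun x => f x == y) s)%N.
  under eq_bigr do rewrite -sum1_count big_mkcond /=.
  rewrite exchange_big /= -sum1_size big_seq [RHS]big_seq.
  apply: eq_bigr => x xs; rewrite -big_mkcond sum1_count.
  rewrite -(eq_count (a1 := pred1 (f x))) ?count_uniq_mem ?undup_uniq //.
  by rewrite mem_undup map_f.
elim: (undup _) => [|y t IH]; first by rewrite big_nil.
by rewrite big_cons /= mulnS leq_add.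
Qed.

Lemma uniq_leq_count (a : pred T) A B : uniq A -> {subset A <= B} ->
  all a A -> (size A <= count a B)%N.
Proof.
move=> uA AB /allP aA; rewrite -size_filter uniq_leq_size // => x xA.
by rewrite mem_filter aA ?AB.
Qed.

End UniqSequences.

(* Each nonzero term [f i] forces the next [f i - 1] terms to vanish, so only
   the last nonzero term can overshoot. *)
Lemma sum_sparse (f : nat -> nat) (n v : nat) :
    (forall i, i < n -> f i <= v)%N ->
    (forall i j, i < j -> j < n -> 0 < f i -> 0 < f j ->
      (forall k, i < k < j -> f k = 0) -> i + f i <= j)%N ->
  (\sum_(i < n) f i <= n + v)%N.
Proof.
move=> fv sparse.
suff inv m : (m <= n)%N -> (\sum_(i < m) f i = 0)%N \/
    exists i, [/\ (i < m)%N, (0 < f i)%N, (forall k, i < k < m -> f k = 0)%N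
      & (\sum_(i < m) f i <= i + f i)%N].
  case: (inv n) => // [->|[i [lt_in _ _ le]]] //.
  by have := fv _ lt_in; lia.
elim: m => [|m IH] lt_mn; first by left; rewrite big_ord0.
rewrite big_ord_recr /=; case: (posnP (f m)) => [fm0|fm_gt0].
  rewrite fm0 addn0; case: IH => [|->|[i [lt_im fi0 z le]]]; first exact: ltnW.
    by left.
  right; exists i; split=> // [|k /andP[ik]]; first exact: ltnW.
  by rewrite ltnS leq_eqVlt => /predU1P[->|km] //; apply: z; rewrite ik.
right; exists m; split=> // [k|]; first by lia.
case: IH => [|->|[i [lt_im fi0 z le]]] //; first exact: ltnW.
  by rewrite add0n leq_addl.
by rewrite leq_add2r (leq_trans le) // sparse.
Qed.

(** * Heights and slopes in the plane *)

Section Directions.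
Variable R : realFieldType.
Implicit Types (p q u w : R * R) (s t z : R).

(** The intercept at abscissa 0 of the line of slope [t] through [p], so equal heights mean a common
    line of slope [t]. *)
Definition height t p := p.2 - t * p.1.
Definition slope p q := (p.2 - q.2) / (p.1 - q.1).

(** The height difference at [t] is [(slope p q - t) * (p.1 - q.1)]: constant for a vertical pair,
    and otherwise changing sign exactly at the slope. *)
Lemma slope_between t s p q :
    height t p <= height t q -> height s q < height s p ->
  p.1 != q.1 /\ (t <= slope p q < s \/ s < slope p q <= t).
Proof.
rewrite /height => lt_t lt_s.
have [e|ne] := eqVneq p.1 q.1; first by move: lt_t lt_s; rewrite e; lra.
split=> //; have [z ez] : exists z, z = slope p q by exists (slope p q).
have dE : p.2 - q.2 = z * (p.1 - q.1) by rewrite ez mulfVK // subr_eq0.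
rewrite -ez.
have l1 : (z - t) * (p.1 - q.1) <= 0 by rewrite mulrBl -dE; lra.
have l2 : 0 < (z - s) * (p.1 - q.1) by rewrite mulrBl -dE; lra.
have [lt0|gt0|e] := ltgtP (p.1 - q.1) 0.
- left; rewrite nmulr_lle0 // in l1; rewrite nmulr_lgt0 // in l2.
  by apply/andP; split; lra.
- right; rewrite pmulr_lle0 // in l1; rewrite pmulr_lgt0 // in l2.
  by apply/andP; split; lra.
- by rewrite e mulr0 ltxx in l2.
Qed.

Lemma height_slope p q : p.1 != q.1 ->
  height (slope p q) p = height (slope p q) q.
Proof.
rewrite -subr_eq0 => ne; have := mulfVK ne (p.2 - q.2).
by rewrite /height -/(slope p q); lra.
Qed.

Lemma eq_height2 s t p q : s != t ->
  height s p = height s q -> height t p = height t q -> p = q.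
Proof.
case: p q => [px py] [qx qy]; rewrite /height /= -subr_eq0 => ne es et.
have /eqP : (s - t) * (px - qx) = 0 by lra.
rewrite mulf_eq0 (negPf ne) subr_eq0 => /eqP e.
by congr (_, _) => //; rewrite e in es; lra.
Qed.

(* The graphs of [fun t => height t q], for [q] on a common line of slope [s],
   form a pencil; a line missing its centre meets them at distinct [t]. *)
Lemma pencil_slopes_uniq s p (T : seq (R * R)) : uniq T ->
    (forall q, q \in T -> p.1 != q.1) ->
    (forall q, q \in T -> slope p q != s) ->
    {in T &, forall q q', height s q = height s q'} ->
  uniq [seq slope p q | q <- T].
Proof.
move=> uT pT sT hT; rewrite map_inj_in_uniq // => q q' qT q'T e.
apply: (@eq_height2 (slope p q) s); first exact: sT.
  by rewrite -height_slope ?pT // e height_slope ?pT.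
exact: hT.
Qed.

(** * The lowest [B] points between consecutive slopes *)

Variables (P : seq (R * R)) (S : seq R) (B : nat).
Hypothesis uP : uniq P.
Hypothesis S_sorted : sorted <%R S.
Hypothesis slopeS : {in P &, forall p q, p.1 != q.1 -> slope p q \in S}.
Hypothesis le_B : (B <= size P)%N.

Local Notation Sn := (nth 0 S).

(* [cut i] is larger than exactly the first [i] slopes. *)
Definition cut i :=
  if i is j.+1 then
    if (i < size S)%N then (Sn j + Sn i) / 2 else Sn j + 1
  else Sn 0 - 1.

Lemma Sn_lt i j : (i < size S)%N -> (j < size S)%N -> (Sn i < Sn j) = (i < j)%N.
Proof. by move=> iS jS; rewrite (lt_sorted_ltn_nth 0 S_sorted). Qed.

Lemma Sn_le i j : (i < size S)%N -> (j < size S)%N ->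
  (Sn i <= Sn j) = (i <= j)%N.
Proof. by move=> iS jS; rewrite leNgt Sn_lt // -leqNgt. Qed.

Lemma cut_gt i j : (j < i)%N -> (i <= size S)%N -> Sn j < cut i.
Proof.
case: i => // i; rewrite ltnS /= => ji iS.
have le : Sn j <= Sn i by rewrite Sn_le // (leq_ltn_trans ji).
case: ifP => [lt_iS|_]; last lra.
have : Sn i < Sn i.+1 by rewrite Sn_lt.
lra.
Qed.

Lemma cut_lt i j : (i <= j)%N -> (j < size S)%N -> cut i < Sn j.
Proof.
case: i => [_ jS|i ij jS] /=.
  have : Sn 0 <= Sn j by rewrite Sn_le // (leq_ltn_trans _ jS).
  lra.
have iS := leq_ltn_trans ij jS; rewrite iS.
have : Sn i.+1 <= Sn j by rewrite Sn_le.
have : Sn i < Sn i.+1 by rewrite Sn_lt // ltnW.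
lra.
Qed.

(* The [B] lowest points in the ordering in force between two slopes. *)
Definition low i := take B (sort (relpre (height (cut i)) <=%R) P).

Lemma low_uniq i : uniq (low i).
Proof. by rewrite take_uniq // sort_uniq. Qed.

Lemma size_low i : size (low i) = B.
Proof. by rewrite size_takel // size_sort. Qed.

Lemma low_sub i p : p \in low i -> p \in P.
Proof. by move/mem_take; rewrite mem_sort. Qed.

Lemma low_height i p q : p \in low i -> q \in P -> q \notin low i ->
  height (cut i) p <= height (cut i) q.
Proof.
set r := relpre (height (cut i)) <=%R => pl qP ql.
have tr : transitive r by move=> x y z; exact: le_trans.
have to : total r by move=> x y; exact: le_total.
have := sort_sorted to P; rewrite -(cat_take_drop B (sort r P)).
rewrite sorted_pairwise // pairwise_cat => /andP[/allrelP lr _].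
apply: lr => //; have : q \in sort r P by rewrite mem_sort.
by rewrite -{1}(cat_take_drop B (sort r P)) mem_cat => /orP[/(negP ql)|].
Qed.

(** The order at [cut i] can be strictly reversed at [Sn i] only through a slope in [[cut i, Sn i)],
    and [S] has no element there. *)
Lemma low_height_before i p q : (i < size S)%N ->
  p \in low i -> q \in P -> q \notin low i ->
  height (Sn i) p <= height (Sn i) q.
Proof.
move=> iS pl qP ql; rewrite leNgt; apply/negP => lt.
have [ne] := slope_between (low_height pl qP ql) lt.
have /(nthP 0)[k kS <-] := slopeS (low_sub pl) qP ne.
have c := cut_lt (leqnn i) iS.
case=> /andP[a b]; last lra.
rewrite Sn_lt // in b; have := cut_gt b (ltnW iS); lra.
Qed.

Lemma low_height_after i p q : (i < size S)%N ->
  p \in low i.+1 -> q \in P -> q \notin low i.+1 ->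
  height (Sn i) p <= height (Sn i) q.
Proof.
move=> iS pl qP ql; rewrite leNgt; apply/negP => lt.
have [ne] := slope_between (low_height pl qP ql) lt.
have /(nthP 0)[k kS <-] := slopeS (low_sub pl) qP ne.
have c := cut_gt (leqnn i.+1) iS.
case=> /andP[a b]; first lra.
rewrite Sn_lt // in a; have := cut_lt a kS; lra.
Qed.

(** * Exchanges at a slope and the gap between them *)

Definition exits i := seq_diff (low i) (low i.+1).
Definition entries i := seq_diff (low i.+1) (low i).

Lemma size_entries i : size (entries i) = size (exits i).
Proof. by apply: size_seq_diffC; rewrite ?low_uniq // !size_low. Qed.

(** At [Sn i] both neighbouring orders hold weakly: the earlier one puts [p] below [q], the later
    one [q] below [p]. *)
Lemma exits_entries_height i p q : (i < size S)%N ->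
  p \in exits i -> q \in entries i -> height (Sn i) p = height (Sn i) q.
Proof.
move=> iS; rewrite !mem_seq_diff => /andP[p1 p2] /andP[q1 q2].
apply/le_anti/andP; split.
  exact: low_height_before iS p2 (low_sub q2) q1.
exact: low_height_after iS q2 (low_sub p2) p1.
Qed.

(** The low set is constant between the two exchanges. At [Sn j] some [p] leaves and some [w]
    enters. Either [p] was strictly below the line of the first exchange and trades order with all
    its entries, or [w] was strictly above and trades order with all its exits, at distinct
    slopes. *)
Lemma exits_gap i j : (i < j)%N -> (j < size S)%N ->
    (0 < size (exits i))%N -> (0 < size (exits j))%N ->
    (forall k, (i < k < j)%N -> size (exits k) = 0%N) ->
  (i + size (exits i) <= j)%N.
Proof.
move=> ij jS ei ej z; have iS := ltn_trans ij jS.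
have lowE : low i.+1 =i low j.
  have : forall k, (i < k)%N -> (k <= j)%N -> low i.+1 =i low k.
    elim=> // k IH; rewrite ltnS leq_eqVlt => /predU1P[->|ik] kj //.
    move=> x; rewrite IH //; last exact: ltnW.
    apply: seq_diff_eq0; rewrite ?low_uniq ?size_low //.
    by apply: z; rewrite ik kj.
  exact.
have [p0 p0e] : exists p, p \in exits i.
  by case: (exits i) ei => // p l _; exists p; rewrite mem_head.
have [q0 q0e] : exists q, q \in entries i.
  move: ei; rewrite -size_entries; case: (entries i) => // q l _.
  by exists q; rewrite mem_head.
have [p pe] : exists p, p \in exits j.
  by case: (exits j) ej => // p l _; exists p; rewrite mem_head.
have [w we] : exists q, q \in entries j.
  move: ej; rewrite -size_entries; case: (entries j) => // q l _.
  by exists q; rewrite mem_head.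
have v0 := exits_entries_height iS p0e q0e.
have v1 := exits_entries_height jS pe we.
have hent q : q \in entries i -> height (Sn i) q = height (Sn i) p0.
  by move=> qe; rewrite (exits_entries_height iS p0e qe).
have hexi q : q \in exits i -> height (Sn i) q = height (Sn i) p0.
  by move=> qe; rewrite (exits_entries_height iS qe q0e) v0.
move: (p0e) (q0e) (pe) (we); rewrite !mem_seq_diff.
move=> /andP[p0n p0l] /andP[q0n q0l] /andP[pn pl] /andP[wn wl].
have pP := low_sub pl; have wP := low_sub wl.
have ltS : Sn i < Sn j by rewrite Sn_lt.
(* The slopes larger than [Sn i] and at most [Sn j]. *)
pose J := [seq Sn k | k <- iota i.+1 (j - i)].
have J_in x y : x \in P -> y \in P -> x.1 != y.1 ->
    Sn i < slope x y <= Sn j -> slope x y \in J.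
  move=> xP yP ne; have /(nthP 0)[k kS <-] := slopeS xP yP ne.
  rewrite Sn_lt // Sn_le // => /andP[ik kj].
  by rewrite map_f // mem_iota ik addSn ltnS subnKC // ltnW.
(* The pencil argument injects [T] into [J], which has [j - i] terms. *)
have bound x (T : seq (R * R)) : x \in P -> uniq T -> {subset T <= P} ->
    {in T &, forall q q', height (Sn i) q = height (Sn i) q'} ->
    (forall q, q \in T -> x.1 != q.1 /\ Sn i < slope x q <= Sn j) ->
    (i + size T <= j)%N.
  move=> xP uT TP hT sT.
  suff : (size [seq slope x q | q <- T] <= size J)%N.
    by rewrite !size_map size_iota leq_subRL // ltnW.
  apply: uniq_leq_size => [|_ /mapP[q qT ->]].
    apply: (pencil_slopes_uniq (s := Sn i)) => // q /sT[] // _.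
    by case/andP=> lt _; rewrite gt_eqF.
  by have [ne sl] := sT q qT; apply: J_in => //; exact: TP.
(* If [p] is off the line of the first exchange, it is below it: [p] is still low after [Sn i],
   while [p0] is not. *)
have [hp|hp] := eqVneq (height (Sn i) p) (height (Sn i) p0); last first.
  have lp : height (Sn i) p < height (Sn i) p0.
    rewrite lt_neqAle hp /=; apply: low_height_after iS _ (low_sub p0l) p0n.
    by rewrite lowE.
  rewrite -size_entries; apply: (bound p) => // [|q|q q' qe q'e|q qe].
  - exact/seq_diff_uniq/low_uniq.
  - by rewrite mem_seq_diff => /andP[_ /low_sub].
  - by rewrite !hent.
  have lq : height (Sn j) q <= height (Sn j) p.
    rewrite v1; apply: low_height_before jS _ wP wn.
    by move: qe; rewrite mem_seq_diff lowE => /andP[].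
  have [ne] :=
    slope_between lq (etrans (congr1 (fun h => _ < h) (hent q qe)) lp).
  have -> : slope q p = slope p q.
    by rewrite /slope -mulrNN -invrN !opprB.
  case=> [/andP[a b]|->]; first lra.
  by rewrite eq_sym.
(* If [w] were on this line together with [p], the two would agree in height at both [Sn i] and
   [Sn j], hence coincide. *)
have [hw|hw] := eqVneq (height (Sn i) w) (height (Sn i) p0).
  have ne : Sn i != Sn j by rewrite lt_eqF.
  have e := eq_height2 ne (etrans hp (esym hw)) v1.
  by move: wn; rewrite -e pl.
have lw : height (Sn i) p0 < height (Sn i) w.
  rewrite lt_neqAle eq_sym hw /= v0; apply: low_height_after iS q0l wP _.
  by rewrite lowE.
apply: (bound w) => // [|q|q q' qe q'e|q qe].
- exact/seq_diff_uniq/low_uniq.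
- by rewrite mem_seq_diff => /andP[_ /low_sub].
- by rewrite !hexi.
have lq : height (Sn j) w <= height (Sn j) q.
  rewrite -v1; move: qe; rewrite mem_seq_diff lowE => /andP[qn /low_sub qP].
  exact: low_height_before jS pl qP qn.
have [ne] := slope_between lq (etrans (congr1 (fun h => h < _) (hexi q qe)) lw).
by case=> [/andP[a b]|->]; first lra.
Qed.

(** * Points on a line, extreme orderings, and the count of slopes *)

Variable v : nat.
Hypothesis vertical : forall x, (count (fun p => p.1 == x) P <= v)%N.
Hypothesis oblique : forall s y, (count (fun p => height s p == y) P <= v)%N.

Lemma size_exits i : (i < size S)%N -> (size (exits i) <= v)%N.
Proof.
move=> iS; case: (posnP (size (exits i))) => [->//|].
rewrite -size_entries; case E : (entries i) => [//|q l] _; rewrite -E.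
apply: leq_trans (oblique (Sn i) (height (Sn i) q)).
rewrite size_entries uniq_leq_count ?seq_diff_uniq ?low_uniq // => [x|].
  by rewrite mem_seq_diff => /andP[_ /low_sub].
apply/allP => x xe; apply/eqP/exits_entries_height => //.
by rewrite E mem_head.
Qed.

(** Since [cut 0] is below every slope, heights there increase strictly from left to right. *)
Lemma low_first p q : p \in low 0 -> q \in P -> q \notin low 0 -> p.1 <= q.1.
Proof.
move=> pl qP ql; rewrite leNgt; apply/negP => lt.
have ne : p.1 != q.1 by rewrite gt_eqF.
have /(nthP 0)[k kS ez] := slopeS (low_sub pl) qP ne.
have := cut_lt (leq0n k) kS; rewrite ez => c.
have := low_height pl qP ql; have := height_slope ne; rewrite /height => e l.
have : 0 < (slope p q - cut 0) * (p.1 - q.1) by rewrite mulr_gt0 ?subr_gt0.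
lra.
Qed.

Lemma low_last p q : p \in low (size S) -> q \in P -> q \notin low (size S) ->
  q.1 <= p.1.
Proof.
move=> pl qP ql; rewrite leNgt; apply/negP => lt.
have ne : p.1 != q.1 by rewrite lt_eqF.
have /(nthP 0)[k kS ez] := slopeS (low_sub pl) qP ne.
have := cut_gt kS (leqnn _); rewrite ez => c.
have := low_height pl qP ql; have := height_slope ne; rewrite /height => e l.
have : 0 < (cut (size S) - slope p q) * (q.1 - p.1).
  by rewrite mulr_gt0 ?subr_gt0.
lra.
Qed.

(** At least as many points lie outside both sets as lie in both. If some [p] lies in both, an
    outside point is neither left nor right of [p], hence on the vertical line through [p]. *)
Lemma size_low_diff : (B.*2 <= size P)%N ->
  (B <= size (seq_diff (low 0) (low (size S))) + v)%N.
Proof.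
move=> leB; set L := low 0; set U := low (size S).
have dI : (size (seq_diff L U) + count (mem U) L = B)%N.
  rewrite -(size_low 0) -(count_predC (mem U) L) addnC /seq_diff size_filter.
  by congr addn.
suff : (count (mem U) L <= v)%N by lia.
case: (posnP (count (mem U) L)) => [->//|].
rewrite -has_count => /hasP[p pL pU].
pose C := seq_diff P (undup (L ++ U)).
have : (count (mem U) L <= size C)%N.
  have sLU : (size (undup (L ++ U)) + count (mem U) L = B.*2)%N.
    have -> : size (undup (L ++ U)) = size (seq_diff L U ++ U).
      apply/perm_size/uniq_perm; rewrite ?undup_uniq //.
        rewrite cat_uniq seq_diff_uniq ?low_uniq //= andbT.
        by apply/hasPn => x /= xU; rewrite mem_seq_diff xU.
      move=> x; rewrite mem_undup !mem_cat mem_seq_diff.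
      by case: (x \in U); rewrite ?orbT ?orbF.
    by rewrite size_cat /U size_low -/U; lia.
  have : (size P <= size (undup (L ++ U)) + size C)%N.
    rewrite -size_cat uniq_leq_size // => x xP; rewrite mem_cat mem_seq_diff xP.
    by case: (x \in undup _).
  lia.
move/leq_trans; apply; apply: leq_trans (vertical p.1).
apply: uniq_leq_count; first exact: seq_diff_uniq.
  by move=> x; rewrite mem_seq_diff => /andP[].
apply/allP => x; rewrite mem_seq_diff mem_undup mem_cat negb_or.
case/andP=> /andP[xL xU] xP; apply/eqP/le_anti/andP; split.
  exact: low_last pU xP xU.
exact: low_first pL xP xL.
Qed.

End Directions.

(** The first low set loses at least [B - v] points on the way to the last; by the triangle
    inequality the exits add up to at least that, and sparsity bounds them by [size S + v]. *)
Lemma directions_lower_bound (R : realFieldType) (P : seq (R * R)) (S : seq R)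
    (v : nat) : uniq P -> sorted <%R S ->
    {in P &, forall p q, p.1 != q.1 -> slope p q \in S} ->
    (forall x, (count (fun p => p.1 == x) P <= v)%N) ->
    (forall s y, (count (fun p => height s p == y) P <= v)%N) ->
  ((size P)./2 <= size S + v.*2)%N.
Proof.
move=> uP sS PS vert obl; set B := (size P)./2.
have leB2 : (B.*2 <= size P)%N by rewrite /B; lia.
have leB : (B <= size P)%N by lia.
have := size_low_diff uP sS PS leB vert leB2.
have : (size (seq_diff (low P S B 0) (low P S B (size S))) <=
        \sum_(i < size S) size (exits P S B i))%N.
  elim: (size S) => [|n IH].
    rewrite big_ord0 leqn0 size_eq0; apply/eqP.
    rewrite /seq_diff -(filter_pred0 (low P S B 0)).
    by apply: eq_in_filter => x /= ->.
  rewrite big_ord_recr /=; apply: leq_trans (leq_add IH (leqnn _)).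
  exact/size_seq_diff_triangle/low_uniq.
have : (\sum_(i < size S) size (exits P S B i) <= size S + v)%N.
  apply: (sum_sparse (f := fun i => size (exits P S B i))) => [i iS|].
    exact: size_exits.
  by move=> i j; exact: exits_gap.
lia.
Qed.

(** * Polynomials in two variables *)

Section TwoVariables.
Variable R : realType.
Implicit Types g : {mpoly R[2]}.

Lemma eval2E g a b :
  eval2 g a b =
    \sum_(m <- msupp g) g@_m * (a ^+ m ord0 * b ^+ m (lift ord0 ord0)).
Proof.
rewrite /eval2 mevalE; apply: eq_bigr => m _.
by rewrite big_ord_recl big_ord1 !(tnth_nth 0).
Qed.

(** Without the first variable, the difference is a combination of the [y1 ^+ k - y2 ^+ k]. *)
Lemma subst2_dvd g : (forall m, m \in msupp g -> m ord0 = 0%N) ->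
  mpoly_dvd (y2 - y1) (subst2 g x1 y1 - subst2 g x2 y2).
Proof.
move=> g0; rewrite /subst2 !comp_mpolyE -sumrB.
have dvd (s : seq 'X_{1..2}) : {subset s <= msupp g} -> mpoly_dvd (y2 - y1)
    (\sum_(m <- s) (g@_m *: \prod_(i < 2) tnth [tuple x1; y1] i ^+ m i -
      g@_m *: \prod_(i < 2) tnth [tuple x2; y2] i ^+ m i)).
  elim: s => [|m s IH] sub; first by exists 0; rewrite big_nil mul0r.
  case: IH => [x xs|r er]; first by apply: sub; rewrite inE xs orbT.
  rewrite big_cons er -scalerBr !big_ord_recl !big_ord0 !(tnth_nth 0) /=.
  rewrite g0 ?sub ?mem_head // !expr0 !mul1r !mulr1.
  set k := m _.
  have [h ->] : exists h : {mpoly R[4]}, y1 ^+ k - y2 ^+ k = h * (y2 - y1).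
    by rewrite subrXX; eexists; rewrite mulrC -opprB mulrN -mulNr.
  by exists (g@_m *: h + r); rewrite mulrDl scalerAl.
exact: dvd.
Qed.

(** Here [c] is the coefficient in y of some positive power of x occurring in [g], and [q] is [g]
    restricted to y = b. *)
Lemma eval2_poly g d : has_degree g d ->
    ~ mpoly_dvd (y2 - y1) (subst2 g x1 y1 - subst2 g x2 y2) ->
  exists2 c : {poly R}, c != 0 /\ (size c <= d.+1)%N &
    forall b, exists q : {poly R}, [/\ (size q <= d.+1)%N,
      forall a, q.[a] = eval2 g a b & c.[b] != 0 -> (1 < size q)%N].
Proof.
move=> deg ndvd.
have /hasP[m0 m0g m0_gt0] : has (fun m : 'X_{1..2} => 0 < m ord0)%N (msupp g).
  apply: contraT => /hasPn h; case: ndvd; apply: subst2_dvd => m /h.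
  by rewrite -eqn0Ngt => /eqP.
have mdeg_le (m : 'X_{1..2}) : m \in msupp g ->
    (m ord0 <= d)%N /\ (m (lift ord0 ord0) <= d)%N.
  move/msize_mdeg_lt; rewrite deg mdegE big_ord_recl big_ord1; lia.
have size_le (F : 'X_{1..2} -> R) (e : 'X_{1..2} -> nat) (Q : pred 'X_{1..2}) :
    (forall m, m \in msupp g -> (e m <= d)%N) ->
    (size (\sum_(m <- msupp g | Q m) F m *: 'X^(e m))%R <= d.+1)%N.
  move=> le; apply: leq_trans (size_sum _ _ _) _.
  apply/bigmax_leqP_seq => m mg _; apply: leq_trans (size_scale_leq _ _) _.
  by rewrite size_polyXn ltnS le.
pose j := m0 ord0.
pose c : {poly R} :=
  \sum_(m <- msupp g | m ord0 == j) g@_m *: 'X^(m (lift ord0 ord0)).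
exists c.
  split; last by apply: size_le => m /mdeg_le[].
  have : c`_(m0 (lift ord0 ord0)) != 0.
    (* A monomial is determined by its two exponents, so only [m0] contributes. *)
    rewrite coef_sumMXn (big_rem m0) //= !eqxx /=.
    rewrite big1_seq ?addr0 -?mcoeff_msupp // => m.
    case/andP=> /andP[/eqP e0 /eqP e1].
    rewrite mem_rem_uniq ?msupp_uniq // inE => /andP[/eqP[]].
    apply/mnmP => i; case: (unliftP ord0 i) => [k ->|->] //.
    by rewrite (ord1 k).
  by apply: contra_neq => ->; rewrite coef0.
move=> b; pose q : {poly R} :=
  \sum_(m <- msupp g) (g@_m * b ^+ m (lift ord0 ord0)) *: 'X^(m ord0).
exists q; split=> [|a|cb].
- by apply: size_le => m /mdeg_le[].
- rewrite eval2E horner_sum; apply: eq_bigr => m _.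
  by rewrite hornerZ hornerXn; ring.
- have qj : q`_j = c.[b].
    rewrite coef_sumMXn horner_sum; apply: eq_bigr => m _.
    by rewrite hornerZ hornerXn.
  rewrite ltnNge; apply: contraNN cb => sq; rewrite -qj nth_default //.
  exact: leq_trans sq m0_gt0.
Qed.

End TwoVariables.

Local Open Scope fset_scope.

(** * Quotients as slopes of a planar point set *)

Section QuotientSet.
Variable R : realType.
Implicit Types (g : {mpoly R[2]}) (A : {fset R}).

Lemma quotient_set_gt0 g A : (2 <= #|` A|)%N -> (0 < #|` quotient_set g A|)%N.
Proof.
case E : (enum_fset A) (fset_uniq A) => [|a [|b s]] //=.
rewrite !inE negb_or => /andP[/andP[/eqP ab _] _] _.
have [aA bA] : a \in A /\ b \in A.
  by split; change (a \in enum_fset A) || change (b \in enum_fset A);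
     rewrite E !inE eqxx ?orbT.
rewrite cardfs_gt0; apply/fset0Pn.
exists ((eval2 g a a - eval2 g a b) / (b - a)).
by apply/quotient_setP; exists a, a, a, b.
Qed.

(** One has [n * n <= (size good + d) * n <= d * (size P + n)], and the slope bound with [v = n]
    controls [size P]. *)
Lemma quotient_set_bound g d A : has_degree g d ->
    ~ mpoly_dvd (y2 - y1) (subst2 g x1 y1 - subst2 g x2 y2) ->
  (#|` A| * #|` A| <=
    d * (#|` quotient_set g A|.*2 + 5 * #|` A| + 1))%N.
Proof.
move=> deg ndvd; have [c [c0 sc] gE] := eval2_poly deg ndvd.
set n := #|` A|; set X := quotient_set g A.
have uA : uniq (enum_fset A) by exact: fset_uniq.
pose good := [seq b <- A | c.[b] != 0].
have le_good : (n <= size good + d)%N.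
  rewrite /n -(count_predC (fun b => c.[b] != 0) A) size_filter leq_add2l.
  rewrite -size_filter -ltnS (leq_trans _ sc) // max_poly_roots //.
    apply/allP => b; rewrite mem_filter => /andP[+ _].
    by rewrite /= negbK.
  exact: filter_uniq.
pose G := [seq (b, a) | b <- good, a <- enum_fset A].
pose F (x : R * R) := (- x.1, eval2 g x.2 x.1).
pose P := undup (map F G).
have GP b a : ((b, a) \in G) = (b \in good) && (a \in A).
  apply/allpairsP/andP => [[[b' a'] /= [? ? [-> ->]]]//|[? ?]].
  by exists (b, a).
have uG : uniq G.
  apply: allpairs_uniq; rewrite ?filter_uniq //.
  by move=> [? ?] [? ?] _ _ [-> ->].
have goodA b : b \in good -> b \in A by rewrite mem_filter => /andP[].
have PE p : p \in P -> exists b a,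
    [/\ b \in A, a \in A & p = (- b, eval2 g a b)].
  rewrite mem_undup => /mapP[[b a]]; rewrite GP => /andP[/goodA bA aA] ->.
  by exists b, a.
have fibers : (size good * n <= d * size P)%N.
  rewrite -(size_allpairs pair) -/G; apply: size_fibers => -[x y].
  have [q [sq qE q1]] := gE (- x).
  rewrite -size_filter -(size_map snd); set rs := map _ _.
  have rsP a : a \in rs -> c.[- x] != 0 /\ q.[a] = y.
    case/mapP=> -[b a']; rewrite mem_filter GP mem_filter /F /=.
    case/andP=> /eqP[ex ey] /andP[/andP[cb _] _] ->.
    by rewrite qE -ey -ex opprK.
  have [->//|rs0] := eqVneq rs [::].
  have [a0 a0rs] : exists a, a \in rs.
    by case: rs rs0 {rsP} => // a l _; exists a; rewrite mem_head.
  have [/q1 sq1 _] := rsP _ a0rs.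
  (* As [q] is not constant, [q - y%:P] is nonzero and has at most [d] roots. *)
  have sy : size (q - y%:P) = size q.
    by rewrite size_polyDl // size_polyN (leq_ltn_trans (size_polyC_leq1 _)).
  rewrite -ltnS (leq_trans _ sq) // -sy max_poly_roots //.
  - by rewrite -size_poly_gt0 sy ltnW.
  - by apply/allP => a /rsP[_ e]; rewrite rootE !hornerE e subrr.
  rewrite map_inj_in_uniq ?filter_uniq // => -[b a] [b' a'].
  rewrite !mem_filter /F => /andP[/eqP[e _] _] /andP[/eqP[e' _] _] /= ->.
  by congr (_, _); apply: oppr_inj; rewrite e e'.
have sS : sorted <%R (sort <=%R (enum_fset X)).
  by rewrite sort_lt_sorted fset_uniq.
have half : ((size P)./2 <= #|` X| + n.*2)%N.
  rewrite -[X in (_ <= X + _)%N](size_sort <=%R).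
  apply: directions_lower_bound => //; first exact: undup_uniq.
  - move=> p q /PE[b1 [a1 [b1A a1A ->]]] /PE[b2 [a2 [b2A a2A ->]]] /= ne.
    rewrite mem_sort; apply/quotient_setP; exists a1, a2, b1, b2; split=> //.
      by apply/eqP; rewrite eqr_opp in ne.
    by rewrite /slope /= opprK [(- b1 + _)%R]addrC.
  - move=> x; rewrite -size_filter /n.
    rewrite -(size_map (fun a => (x, eval2 g a (- x))) (enum_fset A)).
    apply: uniq_leq_size => [|p]; first by rewrite filter_uniq ?undup_uniq.
    rewrite mem_filter => /andP[/eqP e /PE[b [a [bA aA pE]]]].
    by apply/mapP; exists a => //; rewrite -e pE /= opprK.
  (* A line that is not vertical has one point per abscissa [- b]. *)
  - move=> s y; rewrite -size_filter /n.
    rewrite -(size_map (fun b => (- b, y - s * b)) (enum_fset A)).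
    apply: uniq_leq_size => [|p]; first by rewrite filter_uniq ?undup_uniq.
    rewrite mem_filter => /andP[/eqP <- /PE[b [a [bA aA ->]]]].
    by apply/mapP; exists b => //; rewrite /height /=; congr (_, _); ring.
(* The last [1] pays for rounding in the half. *)
have sP : (size P <= #|` X|.*2 + 4 * n + 1)%N by lia.
have := leq_mul2l d (size P) (#|` X|.*2 + 4 * n + 1); rewrite sP orbT => le1.
have le2 : (n * n <= (size good + d) * n)%N by rewrite leq_mul2r le_good orbT.
clear -fibers le1 le2; nia.
Qed.

End QuotientSet.

(** * The constant and the final estimate *)

Theorem theorem1p1 (R : realType) (d : nat) :
  exists c : R, 0 < c /\
    forall g : {mpoly R[2]},
      has_degree g d ->
      ~ mpoly_dvd (y2 - y1) (subst2 g x1 y1 - subst2 g x2 y2) ->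
      forall A : {fset R}, (2 <= #|` A|)%N ->
        c * (#|` A|)%:R ^+ 2 <= (#|` quotient_set g A|)%:R.
Proof.
(* [400] is the square of the factor in the threshold [20 * d] below; [d.+1] avoids zero when
   [d = 0]. *)
have pos : 0 < (400 * d.+1 ^ 2)%:R :> R by rewrite ltr0n muln_gt0 expn_gt0.
exists (400 * d.+1 ^ 2)%:R^-1; split=> [|g deg ndvd A A2].
  by rewrite invr_gt0.
rewrite mulrC ler_pdivrMr // -natrX -natrM ler_nat.
have X0 := quotient_set_gt0 g A2; have := quotient_set_bound A deg ndvd.
move: A2 X0; set n := #|` A|; set x := #|` quotient_set g A| => n2 x0 le.
rewrite !expnS expn0 !muln1.
(* For small [n] a single quotient suffices; for large [n] the term [5 * d * n] is at most a quarter
   of [n * n] and is absorbed. *)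
have [small|large] := leqP n (20 * d).
  have : (n * n <= (20 * d) * (20 * d))%N by rewrite leq_mul.
  nia.
have : (20 * d * n <= n * n)%N by rewrite leq_mul2r (ltnW large) orbT.
nia.
Qed.
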